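(* Let $m\ge 1$, $n\ge 0$ be integers, $\mu\in\mathbb{C}$, and let $W$ be the $\mathfrak{sl}_{m|n}(\mathbb{C})$-module (depending on $\mu$) defined in the context. (1) If $m\ge 2$ and $\mu$ is a nonnegative integer, then the submodule $V(\mu)$ of $W$ generated by $x_2^{\mu+1}$ is the unique maximal submodule of $W$. Moreover, $V(\mu)$ itself is irreducible. (2) If $m=1$ and $\mu\in\{0,1,\dots,n-1\}$, then the submodule $V(\mu)$ of $W$ generated by $y_1y_2\cdots y_{\mu+1}$ is the unique maximal submodule of $W$, and $V(\mu)$ itself is irreducible.
   Context: All vector spaces and algebras are over $\mathbb{C}$. $\mathfrak{gl}_{m|n}(\mathbb{C})$ is the general linear Lie superalgebra with matrix units $E_{i,j}$, $1\le i,j\le m+n$ (indices $1,\dots,m$ even, $m+1,\dots,m+n$ odd), and $\mathfrak{sl}_{m|n}(\mathbb{C})=[\mathfrak{gl}_{m|n}(\mathbb{C}),\mathfrak{gl}_{m|n}(\mathbb{C})]$. $W$ is the associative algebra generated by $x_2,\dots,x_m,y_1,\dots,y_n$ subject to $x_ix_j=x_jx_i$, $x_iy_k=y_kx_i$, $y_ky_l=-y_ly_k$ (so $W\cong\mathbb{C}[x_2,\dots,x_m]\otimes\bigwedge^*(\mathbb{C}y_1\oplus\cdots\oplus\mathbb{C}y_n)$), with $x_i$ even and $y_k$ odd. $\frac{\partial}{\partial x_i}$ (even) and $\frac{\partial}{\partial y_k}$ (odd) are the partial differential operators on $W$, with $[\frac{\partial}{\partial x_i},x_j]=\delta_{i,j}$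 and $\frac{\partial}{\partial y_k}y_l+y_l\frac{\partial}{\partial y_k}=\delta_{k,l}$. $W$ is a $\mathfrak{gl}_{m|n}(\mathbb{C})$-module, hence by restriction an $\mathfrak{sl}_{m|n}(\mathbb{C})$-module, with $E_{i,j}$ acting as $e_{i,j}$, where for $i,j=2,\dots,m$ and $k,l=1,\dots,n$: $e_{1,1}=\mu-\sum_{s=2}^m x_s\frac{\partial}{\partial x_s}-\sum_{t=1}^n y_t\frac{\partial}{\partial y_t}$, $e_{i,1}=x_i$, $e_{m+k,1}=y_k$, $e_{1,i}=e_{1,1}\frac{\partial}{\partial x_i}$, $e_{1,m+k}=e_{1,1}\frac{\partial}{\partial y_k}$, $e_{i,j}=x_i\frac{\partial}{\partial x_j}$, $e_{i,m+k}=x_i\frac{\partial}{\partial y_k}$, $e_{m+k,i}=y_k\frac{\partial}{\partial x_i}$, $e_{m+k,m+l}=y_k\frac{\partial}{\partial y_l}$. ''Maximal submodule'' means maximal among proper submodules. *)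

(* Defs.v *)
From HB Require Import structures.
From mathcomp Require Import all_boot all_order all_algebra.
From mathcomp Require Import mpoly complex.
From mathcomp Require Import ring reals.

Set Implicit Arguments.
Unset Strict Implicit.
Unset Printing Implicit Defensive.

Import GRing.Theory.
Local Open Scope ring_scope.

Section Inversions.
Variable n : nat.
Implicit Types A B D : {set 'I_n}.

Definition inv_count A B : nat := #|[set ab in setX A B | (ab.2 < ab.1)%N]|.

Lemma inv_count_sum A B : inv_count A B = (\sum_(a in A) \sum_(b in B) (b < a))%N.
Proof.
rewrite /inv_count -sum1_card pair_big_dep /= big_mkcond [RHS]big_mkcond /=.
apply: eq_bigr => -[a b] _; rewrite inE in_setX /=.
by case: (a \in A); case: (b \in B); case: (b < a)%N.
Qed.

Lemma inv_countUr A B D :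
  [disjoint B & D] -> inv_count A (B :|: D) = (inv_count A B + inv_count A D)%N.
Proof.
move=> dBD; rewrite !inv_count_sum -big_split /=.
apply: eq_bigr => a _; rewrite -bigU //.
by apply: eq_bigl => b; rewrite !inE.
Qed.

Lemma inv_countUl A B D :
  [disjoint A & B] -> inv_count (A :|: B) D = (inv_count A D + inv_count B D)%N.
Proof.
move=> dAB; rewrite !inv_count_sum -bigU //.
by apply: eq_bigl => a; rewrite !inE.
Qed.

Lemma inv_count0l B : inv_count set0 B = 0%N.
Proof. by rewrite inv_count_sum big_set0. Qed.

Lemma inv_count0r A : inv_count A set0 = 0%N.
Proof. by rewrite inv_count_sum big1 // => a _; rewrite big_set0. Qed.

End Inversions.

(* F[x_2, ..., x_m] (x) Lambda(y_1, ..., y_n) with p = m - 1: the element w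
   stands for the sum over S = {s_1 < ... < s_r} of w S * (y_(s_1) ... y_(s_r)).
   The variables x_2, ..., x_m are indexed by 'I_p and y_1, ..., y_n by 'I_n,
   both from 0. *)
Definition superpoly (F : comNzRingType) (p n : nat) : Type :=
  {ffun {set 'I_n} -> {mpoly F[p]}}.

HB.instance Definition _ (F : comNzRingType) p n :=
  GRing.Lmodule.copy (superpoly F p n) {ffun {set 'I_n} -> {mpoly F[p]}}.

Section SuperpolyRing.
Variables (F : comNzRingType) (p n : nat).
Local Notation W := (superpoly F p n).
Implicit Types (f g h : W) (S A B : {set 'I_n}).

Definition spcoef f S : {mpoly F[p]} := (f : {ffun {set 'I_n} -> {mpoly F[p]}}) S.

Lemma spP f g : spcoef f =1 spcoef g -> f = g.
Proof. by move=> e; apply/ffunP. Qed.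

Lemma spcoefD f g S : spcoef (f + g) S = spcoef f S + spcoef g S.
Proof. exact: ffunE. Qed.
Lemma spcoefN f S : spcoef (- f) S = - spcoef f S.
Proof. exact: ffunE. Qed.
Lemma spcoefZ (c : F) f S : spcoef (c *: f) S = c *: spcoef f S.
Proof. exact: ffunE. Qed.
Lemma spcoef0 S : spcoef 0 S = 0.
Proof. exact: ffunE. Qed.

Definition sp_one : W := [ffun S : {set 'I_n} => (S == set0)%:R].

Definition sp_mul f g : W :=
  [ffun S : {set 'I_n} => \sum_(A : {set 'I_n} | A \subset S)
     (-1) ^+ inv_count A (S :\: A) * (spcoef f A * spcoef g (S :\: A))].

Lemma spcoef_mul f g S : spcoef (sp_mul f g) S =
  \sum_(A : {set 'I_n} | A \subset S)
     (-1) ^+ inv_count A (S :\: A) * (spcoef f A * spcoef g (S :\: A)).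
Proof. exact: ffunE. Qed.

Lemma spcoef_one S : spcoef sp_one S = (S == set0)%:R.
Proof. exact: ffunE. Qed.

Lemma sp_mulA : associative sp_mul.
Proof.
move=> f g h; apply: spP => S; rewrite !spcoef_mul.
under eq_bigr => A _ do rewrite spcoef_mul !mulr_sumr.
under [RHS]eq_bigr => C _ do rewrite spcoef_mul mulr_suml mulr_sumr.
rewrite [RHS](exchange_big_dep (fun A : {set 'I_n} => A \subset S)) /=; last first.
  by move=> C A sCS sAC; exact: subset_trans sAC sCS.
apply: eq_bigr => A sAS.
rewrite [RHS](reindex_onto (fun B => A :|: B) (fun C => C :\: A)) /=; last first.
  by move=> C /andP[_ sAC]; rewrite -{1}(setIidPr sAC) setID.
rewrite [RHS](eq_bigl (fun B : {set 'I_n} => B \subset S :\: A)); last first.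
  move=> B; rewrite subsetUl andbT subUset sAS /= subsetD.
  congr (_ && _); rewrite setDUl setDv set0U; apply/eqP/idP.
    by move/setDidPl.
  by move=> d; apply/setDidPl.
apply: eq_bigr => B; rewrite subsetD => /andP[sBS dBA].
have -> : (A :|: B) :\: A = B by rewrite setDUl setDv set0U; apply/setDidPl.
have -> : S :\: A :\: B = S :\: (A :|: B) by rewrite setDDl.
set D := S :\: (A :|: B).
have -> : S :\: A = B :|: D.
  rewrite /D -setDDl; apply/setP=> x; rewrite !inE.
  case xB: (x \in B) => //=; rewrite (subsetP sBS _ xB) andbT.
  by apply: (contraTN _ xB) => xA; rewrite (disjointFl dBA).
have dBD : [disjoint B & D].
  by rewrite -setI_eq0; apply/eqP/setP=> x; rewrite !inE; case: (x \in B); rewrite ?orbT.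
rewrite inv_countUr // inv_countUl; last by rewrite disjoint_sym.
rewrite !exprD.
move: ((-1) ^+ _) ((-1) ^+ _) ((-1) ^+ _) => s1 s2 s3.
ring.
Qed.

Lemma sp_mul1 : left_id sp_one sp_mul.
Proof.
move=> f; apply: spP => S; rewrite spcoef_mul (bigD1 set0) ?sub0set //= big1.
  by rewrite spcoef_one eqxx mul1r setD0 inv_count0l mul1r addr0.
by move=> A /andP[_ /negPf nA]; rewrite spcoef_one nA mul0r mulr0.
Qed.

Lemma sp_mulr1 : right_id sp_one sp_mul.
Proof.
move=> f; apply: spP => S; rewrite spcoef_mul (bigD1 S) //= big1.
  by rewrite spcoef_one setDv eqxx mulr1 inv_count0r mul1r addr0.
move=> A /andP[sAS nA]; rewrite spcoef_one setD_eq0.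
suff /negPf-> : ~~ (S \subset A) by rewrite !mulr0.
by apply: contra nA => sSA; rewrite eqEsubset sAS.
Qed.

Lemma sp_mulDl : left_distributive sp_mul +%R.
Proof.
move=> f g h; apply: spP => S; rewrite spcoefD !spcoef_mul -big_split /=.
by apply: eq_bigr => A _; rewrite spcoefD mulrDl mulrDr.
Qed.

Lemma sp_mulDr : right_distributive sp_mul +%R.
Proof.
move=> f g h; apply: spP => S; rewrite spcoefD !spcoef_mul -big_split /=.
by apply: eq_bigr => A _; rewrite spcoefD !mulrDr.
Qed.

Lemma sp_one_neq0 : sp_one != 0.
Proof.
apply/eqP => /(congr1 (spcoef^~ set0)); rewrite spcoef_one eqxx spcoef0.
by move/eqP; rewrite oner_eq0.
Qed.

HB.instance Definition _ := GRing.Zmodule_isNzRing.Build W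
  sp_mulA sp_mul1 sp_mulr1 sp_mulDl sp_mulDr sp_one_neq0.

Lemma sp_scalerAl (c : F) f g : c *: (f * g) = (c *: f) * g.
Proof.
apply: spP => S; rewrite spcoefZ !spcoef_mul scaler_sumr.
by apply: eq_bigr => A _; rewrite spcoefZ -scalerAl scalerAr.
Qed.

HB.instance Definition _ := GRing.Lmodule_isLalgebra.Build F W sp_scalerAl.

Lemma sp_scalerAr (c : F) f g : c *: (f * g) = f * (c *: g).
Proof.
apply: spP => S; rewrite spcoefZ !spcoef_mul scaler_sumr.
by apply: eq_bigr => A _; rewrite spcoefZ -!scalerAr.
Qed.

HB.instance Definition _ := GRing.Lalgebra_isAlgebra.Build F W sp_scalerAr.

Lemma spcoefM f g S : spcoef (f * g) S =
  \sum_(A : {set 'I_n} | A \subset S)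
     (-1) ^+ inv_count A (S :\: A) * (spcoef f A * spcoef g (S :\: A)).
Proof. exact: spcoef_mul. Qed.

Lemma spcoef1 S : spcoef 1 S = (S == set0)%:R.
Proof. exact: spcoef_one. Qed.

Definition xvar (i : 'I_p) : W := [ffun S : {set 'I_n} => if S == set0 then 'X_i else 0].
Definition yvar (k : 'I_n) : W := [ffun S : {set 'I_n} => (S == [set k])%:R].

Definition dx (i : 'I_p) f : W := [ffun S : {set 'I_n} => (spcoef f S)^`M(i)].
(* left superderivation: y_T = (-1)^#{s in T | s < k} y_k y_(T \ k) for k in T *)
Definition dy (k : 'I_n) f : W :=
  [ffun S : {set 'I_n} => if k \in S then 0
    else (-1) ^+ #|[set s in S | (s < k)%N]| * spcoef f (k |: S)].

Lemma spcoef_xM i f S : spcoef (xvar i * f) S = 'X_i * spcoef f S.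
Proof.
rewrite spcoefM (bigD1 set0) ?sub0set //= big1.
  by rewrite /spcoef ffunE eqxx setD0 inv_count0l mul1r addr0.
by move=> A /andP[_ /negPf nA]; rewrite /spcoef ffunE nA mul0r mulr0.
Qed.

Lemma spcoef_Mx i f S : spcoef (f * xvar i) S = spcoef f S * 'X_i.
Proof.
rewrite spcoefM (bigD1 S) //= big1.
  by rewrite {2}/spcoef ffunE setDv eqxx inv_count0r mul1r addr0.
move=> A /andP[sAS nA]; rewrite {2}/spcoef ffunE setD_eq0.
suff /negPf-> : ~~ (S \subset A) by rewrite !mulr0.
by apply: contra nA => sSA; rewrite eqEsubset sAS.
Qed.

Lemma spcoef_yM k f S : spcoef (yvar k * f) S =
  if k \in S then (-1) ^+ #|[set s in S | (s < k)%N]| * spcoef f (S :\ k) else 0.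
Proof.
rewrite spcoefM; case: ifP => kS.
  rewrite (bigD1 [set k]) ?sub1set //= big1; last first.
    by move=> A /andP[_ /negPf nA]; rewrite /spcoef ffunE nA mul0r mulr0.
  rewrite {1}/spcoef ffunE eqxx mul1r addr0; congr ((-1) ^+ _ * _).
  rewrite inv_count_sum big_set1 -sum1_card big_mkcond [RHS]big_mkcond /=.
  apply: eq_bigr => s _; rewrite !inE.
  by case: (eqVneq s k) => [->|_]; rewrite ?ltnn ?andbF //=; case: (s \in S); case: ltnP.
rewrite big1 // => A sAS; rewrite {1}/spcoef ffunE.
case: eqP => [eA|_]; last by rewrite mul0r mulr0.
by move: sAS; rewrite eA sub1set kS.
Qed.

Lemma xvarC i f : xvar i * f = f * xvar i.
Proof. by apply: spP => S; rewrite spcoef_xM spcoef_Mx mulrC. Qed.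

Lemma spcoef_dx i f S : spcoef (dx i f) S = (spcoef f S)^`M(i).
Proof. exact: ffunE. Qed.

Lemma spcoef_dy k f S : spcoef (dy k f) S =
  if k \in S then 0 else (-1) ^+ #|[set s in S | (s < k)%N]| * spcoef f (k |: S).
Proof. exact: ffunE. Qed.

Lemma card_ltD1 S (k l : 'I_n) :
  l \in S ->
  #|[set s in S | (s < k)%N]| = ((l < k) + #|[set s in S :\ l | (s < k)%N]|)%N.
Proof.
move=> lS; rewrite (cardsD1 l) !inE lS /=; congr (_ + #|pred_of_set _|)%N.
by apply/setP=> s; rewrite !inE andbA.
Qed.

Lemma yvarMM k l f : yvar k * (yvar l * f) = - (yvar l * (yvar k * f)).
Proof.
apply: spP => S; rewrite spcoefN !spcoef_yM !inE.
have [->|nkl] := eqVneq k l; first by rewrite /= mulr0 if_same oppr0.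
rewrite /=.
case kS: (k \in S); case lS: (l \in S); rewrite ?mulr0 ?oppr0 //=.
rewrite (card_ltD1 k lS) (card_ltD1 l kS) setDDl [S :\ l :\ k]setDDl setUC.
have [lk|kl|/val_inj e] := ltngtP (l : nat) (k : nat).
- by rewrite !exprD expr1 expr0; ring.
- by rewrite !exprD expr1 expr0; ring.
- by rewrite e eqxx in nkl.
Qed.

Lemma yvarM k l : yvar k * yvar l = - (yvar l * yvar k).
Proof. by have := yvarMM k l 1; rewrite !mulr1. Qed.

Lemma dx_xM i j f : dx i (xvar j * f) - xvar j * dx i f = (i == j)%:R *: f.
Proof.
apply: spP => S; rewrite spcoefD spcoefN spcoefZ spcoef_dx !spcoef_xM spcoef_dx.
rewrite mderivM mderivX mnm1E addrK.
rewrite eq_sym; case: eqP => [->|_]; last by rewrite !scale0r mul0r.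
have -> : (U_(j) - U_(j) = 0)%MM by apply/mnmP=> l; rewrite mnmBE mnm0E subnn.
by rewrite mpolyX0 !scale1r mul1r.
Qed.

Lemma dx_yM i k f : dx i (yvar k * f) = yvar k * dx i f.
Proof.
apply: spP => S; rewrite spcoef_dx !spcoef_yM spcoef_dx.
case: ifP => _; last by rewrite mderiv0.
by rewrite -signr_odd; case: odd; rewrite ?mulN1r ?mul1r ?mderivN.
Qed.

Lemma dy_xM k i f : dy k (xvar i * f) = xvar i * dy k f.
Proof.
apply: spP => S; rewrite spcoef_dy !spcoef_xM spcoef_dy.
by case: ifP => _; rewrite ?mulr0 // mulrCA.
Qed.

Lemma dy_yM k l f : dy k (yvar l * f) + yvar l * dy k f = (k == l)%:R *: f.
Proof.
apply: spP => S; rewrite spcoefD spcoefZ spcoef_dy !spcoef_yM spcoef_dy !inE.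
have [->|nkl] := eqVneq k l.
  rewrite scale1r /=; case: ifP => lS.
    rewrite add0r setD1K // mulrA -exprD (card_ltD1 l lS) ltnn add0n addnn.
    by rewrite -signr_odd odd_double mul1r.
  rewrite addr0 setU1K ?lS // mulrA -exprD.
  have -> : [set s in l |: S | (s < l)%N] = [set s in S | (s < l)%N].
    apply/setP=> s; rewrite !inE; case: (eqVneq s l) => [->|//].
    by rewrite ltnn !andbF.
  by rewrite addnn -signr_odd odd_double mul1r.
rewrite scale0r /=.
case kS: (k \in S); case lS: (l \in S); rewrite ?mulr0 ?andbF ?addr0 //=.
have -> : (k |: S) :\ l = k |: (S :\ l).
  apply/setP=> s; rewrite !inE; case: (eqVneq s l) => [->|//=].
  by rewrite eq_sym (negPf nkl).
rewrite (card_ltD1 k lS) (@card_ltD1 (k |: S) l k) ?setU11 // setU1K ?kS //.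
have [lk|kl|/val_inj e] := ltngtP (l : nat) (k : nat).
- by rewrite !exprD expr1 expr0; ring.
- by rewrite !exprD expr1 expr0; ring.
- by rewrite e eqxx in nkl.
Qed.

Lemma dx1 i : dx i 1 = 0.
Proof.
apply: spP => S; rewrite spcoef_dx spcoef1 spcoef0.
by case: (S == set0); rewrite ?mderiv0 // -mpolyC1 mderivC.
Qed.

Lemma dy1 k : dy k 1 = 0.
Proof.
apply: spP => S; rewrite spcoef_dy spcoef1 spcoef0; case: ifP => // _.
suff /negPf-> : k |: S != set0 by rewrite mulr0.
by apply/set0Pn; exists k; rewrite setU11.
Qed.

(* With the relations above: 1, the x_i and the y_k generate W. *)
Lemma sp_ind (P : W -> Prop) :
  P 1 ->
  (forall (c : F) f g, P f -> P g -> P (c *: f + g)) ->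
  (forall i f, P f -> P (xvar i * f)) ->
  (forall k f, P f -> P (yvar k * f)) ->
  forall f, P f.
Proof.
move=> P1 Plin Px Py.
have P0 : P 0 by rewrite -(addNr 1) -scaleN1r; exact: Plin.
have PD f g : P f -> P g -> P (f + g) by rewrite -{2}[f]scale1r; exact: Plin.
have PZ c f : P f -> P (c *: f) by rewrite -[_ *: _]addr0 => Pf; exact: Plin.
pose dl S q : W := [ffun T : {set 'I_n} => if T == S then q else 0].
have dlE S q T : spcoef (dl S q) T = if T == S then q else 0 by exact: ffunE.
have Pm m : P (dl set0 'X_[m]).
  have [d] := ubnP (mdeg m); elim: d m => // d IH m.
  have [->|/eqP m0] := eqVneq m 0%MM.
    move=> _; suff -> : dl set0 'X_[0] = 1 by [].
    by apply: spP => T; rewrite dlE spcoef1 mpolyX0; case: eqP.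
  have [i mi] : exists i, m i != 0%N.
    apply/existsP; apply: contraT => /existsPn m_eq; case: m0; apply/mnmP=> i.
    by rewrite mnm0E; apply/eqP; have := m_eq i; rewrite negbK.
  have em : (U_(i) + (m - U_(i)) = m)%MM.
    apply/mnmP=> j; rewrite mnmDE mnmBE mnm1E; case: eqP => [<-|_].
      by rewrite subnKC // lt0n.
    by rewrite subn0.
  rewrite ltnS -{1 2}em mdegD mdeg1 add1n => lemd.
  have -> : dl set0 'X_[U_(i) + (m - U_(i))] = xvar i * dl set0 'X_[(m - U_(i))].
    by apply: spP => T; rewrite spcoef_xM !dlE mpolyXD; case: eqP; rewrite ?mulr0.
  by apply: Px; exact: IH.
have Pdl0 q : P (dl set0 q).
  elim/mpolyind: q => [|c m q _ _ IH].
    suff -> : dl set0 0 = 0 by [].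
    by apply: spP => T; rewrite dlE spcoef0 if_same.
  suff -> : dl set0 (c *: 'X_[m] + q) = c *: dl set0 'X_[m] + dl set0 q by exact: Plin.
  apply: spP => T; rewrite spcoefD spcoefZ !dlE.
  by case: eqP; rewrite ?scaler0 ?addr0.
have Pdl S q : P (dl S q).
  have [d] := ubnP #|S|; elim: d S => // d IH S.
  have [->|/set0Pn[k kS]] := eqVneq S set0; first by [].
  rewrite (cardsD1 k) kS ltnS => leSd.
  have /(Py k) /(PZ ((-1) ^+ #|[set s in S | (s < k)%N]|)) := IH (S :\ k) leSd.
  congr P; apply: spP => T; rewrite spcoefZ spcoef_yM !dlE.
  have [->|nTS] := eqVneq T S.
    rewrite kS eqxx -signr_odd -[in X in _ *: X]signr_odd.
    by case: odd; rewrite ?scaleN1r ?scale1r ?mulN1r ?mul1r ?opprK.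
  case: ifP => kT; last by rewrite scaler0.
  case: eqP => [e|_]; last by rewrite mulr0 scaler0.
  by case/eqP: nTS; rewrite -(setD1K kT) e setD1K.
move=> f; suff -> : f = \sum_(S : {set 'I_n}) dl S (spcoef f S).
  by elim/big_ind: _ => //.
apply: spP => T.
have -> : spcoef (\sum_S dl S (spcoef f S)) T = \sum_S spcoef (dl S (spcoef f S)) T.
  by apply: (big_morph (spcoef^~ T)) => [g h|]; rewrite (spcoefD, spcoef0).
rewrite (bigD1 T) //= dlE eqxx big1 ?addr0 // => S nST.
by rewrite dlE eq_sym (negPf nST).
Qed.

(* b = true is the odd component *)
Definition sp_part (b : bool) f : W :=
  [ffun S : {set 'I_n} => if odd #|S| == b then spcoef f S else 0].

End SuperpolyRing.

Section GeneralLinear.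
Variables (F : comNzRingType) (m n : nat).
Local Notation gl := 'M[F]_(m + n).
Implicit Types X Y : gl.

Definition gl_odd (i : 'I_(m + n)) : bool := (m <= i)%N.

Definition gl_part (b : bool) X : gl :=
  \matrix_(i, j) if gl_odd i (+) gl_odd j == b then X i j else 0.

Definition superbracket X Y : gl :=
  X *m Y - \sum_(a : bool) \sum_(b : bool)
             (-1) ^+ (a && b) *: (gl_part b Y *m gl_part a X).

(* [gl, gl]: finite sums of brackets (coefficients are absorbed by bilinearity) *)
Definition in_sl X : Prop :=
  exists s : seq (gl * gl), X = \sum_(ab <- s) superbracket ab.1 ab.2.

End GeneralLinear.

Section Module.
Variables (F : comNzRingType) (p n : nat) (mu : F).
Local Notation W := (superpoly F p n).
Local Notation gl := 'M[F]_(p.+1 + n).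

Definition e11 (w : W) : W :=
  mu *: w - \sum_(s < p) xvar F n s * dx s w - \sum_(t < n) yvar F p t * dy t w.

(* The index 1, an index i + 2 in {2, ..., m}, or an index m + (k + 1). *)
Variant gl_index := Ifirst | Ieven of 'I_p | Iodd of 'I_n.

Definition gl_index_of (i : 'I_(p.+1 + n)) : gl_index :=
  match split i with
  | inl a => if unlift ord0 a is Some i' then Ieven i' else Ifirst
  | inr k => Iodd k
  end.

Definition e_op (i j : 'I_(p.+1 + n)) (w : W) : W :=
  match gl_index_of i, gl_index_of j with
  | Ifirst,  Ifirst  => e11 w
  | Ieven i, Ifirst  => xvar F n i * w
  | Iodd k,  Ifirst  => yvar F p k * w
  | Ifirst,  Ieven i => e11 (dx i w)
  | Ifirst,  Iodd k  => e11 (dy k w)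
  | Ieven i, Ieven j => xvar F n i * dx j w
  | Ieven i, Iodd k  => xvar F n i * dy k w
  | Iodd k,  Ieven i => yvar F p k * dx i w
  | Iodd k,  Iodd l  => yvar F p k * dy l w
  end.

Definition gl_act (X : gl) (w : W) : W := \sum_i \sum_j X i j *: e_op i j w.

(* graded = true: only Z/2-graded submodules are considered;
   graded = false: all invariant subspaces. *)
Variable graded : bool.
Implicit Types (U V : W -> Prop).

Definition sl_submodule U : Prop :=
  [/\ U 0,
      forall (c : F) (u v : W), U u -> U v -> U (c *: u + v),
      forall (X : gl) (u : W), in_sl X -> U u -> U (gl_act X u) &
      graded -> forall (b : bool) (u : W), U u -> U (sp_part b u)].

Definition sub_le U V : Prop := forall w, U w -> V w.
Definition sub_proper U : Prop := exists w, ~ U w.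

Definition generated_submodule (g : W) : W -> Prop :=
  fun w => forall U, sl_submodule U -> U g -> U w.

Definition maximal_submodule U : Prop :=
  [/\ sl_submodule U, sub_proper U &
      forall U', sl_submodule U' -> sub_proper U' -> sub_le U U' -> sub_le U' U].

Definition unique_maximal_submodule V : Prop :=
  maximal_submodule V /\
  forall U, maximal_submodule U -> forall w, U w <-> V w.

Definition irreducible_submodule V : Prop :=
  [/\ sl_submodule V,
      exists w, V w /\ w <> 0 &
      forall U, sl_submodule U -> sub_le U V ->
        (forall w, U w -> w = 0) \/ sub_le V U].

End Module.

(* Main.v *)
(* Write W_(> d) for the span of the monomials of degree > d = mu. Every
   off-diagonal E_(i,j) lies in sl, so a submodule is stable under multiplication
   by each variable z, under the z d/dz' with z <> z', and under the lowering
   operators e11 d/dz, which multiply a monomial of degree k by d - k + 1 times a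
   derivative. Hence lowering works inside degrees <= d and inside degrees > d,
   but it annihilates degree d + 1; so W_(> d) is a submodule.

   - Moving variables by z d/dz' and multiplying, the generator yields W_(> d).
   - A nonzero element of W_(> d) can be lowered to a nonzero element of degree
     d + 1, and the z d/dz' turn that into a multiple of the generator.
   - An element outside W_(> d) can be lowered to c + v with c a nonzero constant
     and v in W_(> d). Multiplying by the generator gives a nonzero element of
     W_(> d), so the submodule contains W_(> d), hence v, hence 1, hence W.

   Both parts are the same argument: the generator is the monomial G of degree
   d + 1 all of whose variables are "preferred", that is, equal to x_2 when
   m >= 2, and among y_1, ..., y_(d+1) when m = 1. *)
Require Import Defs.
From HB Require Import structures.
From mathcomp Require Import all_boot all_order all_algebra.
From mathcomp Require Import mpoly complex.
From mathcomp Require Import reals.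
From mathcomp Require boolp.
Import GRing.Theory.
Local Open Scope ring_scope.

Set Implicit Arguments.
Unset Strict Implicit.
Unset Printing Implicit Defensive.

(** * Monomials *)

Section Monomials.
Variables (p n : nat).

Definition spmon := ('X_{1..p} * {set 'I_n})%type.
(* inl i stands for x_(i+2) and inr k for y_(k+1). *)
Definition spvar := ('I_p + 'I_n)%type.
Implicit Types (M N : spmon) (z : spvar) (P : pred spvar).

Definition mult z M : nat :=
  match z with inl i => M.1 i | inr k => k \in M.2 end.

(** Odd variables square to zero, so this says that [z] times [M] is nonzero; when it fails,
    [addv z M] is just [M]. *)
Definition addable z M : bool :=
  match z with inl _ => true | inr k => k \notin M.2 end.

Definition addv z M : spmon :=
  match z with
  | inl i => ((M.1 + U_(i))%MM, M.2)
  | inr k => (M.1, k |: M.2)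
  end.

Definition delv z M : spmon :=
  match z with
  | inl i => ((M.1 - U_(i))%MM, M.2)
  | inr k => (M.1, M.2 :\ k)
  end.

Lemma monP M N : mult^~ M =1 mult^~ N -> M = N.
Proof.
case: M N => [a S] [b T] e; congr pair.
  by apply/mnmP => i; exact: (e (inl i)).
by apply/setP => k; have := e (inr k); rewrite /=; do 2 case: (k \in _).
Qed.

Lemma mult_addv z z' M :
  addable z M -> mult z' (addv z M) = (mult z' M + (z == z'))%N.
Proof.
case: z z' => [i|k] [j|l] //=; rewrite ?addn0 //.
  by rewrite mnmDE mnm1E => _; congr (_ + _)%N.
move=> kM; rewrite -[inr k == _]/(k == l) !inE.
by have [<-|_] := eqVneq k l; rewrite ?(negPf kM) ?addn0.
Qed.

Lemma mult_delv z z' M : mult z' (delv z M) = (mult z' M - (z == z'))%N.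
Proof.
case: z z' => [i|k] [j|l] //=; rewrite ?subn0 //.
  by rewrite mnmBE mnm1E.
rewrite -[inr k == _]/(k == l) !inE.
by have [_|_] := eqVneq k l; rewrite ?subn0 //=; case: (l \in _).
Qed.

Lemma addable_delv z M : (0 < mult z M)%N -> addable z (delv z M).
Proof. by case: z => //= k; rewrite !inE eqxx. Qed.

Lemma addable_delv_neq z z' M :
  z != z' -> addable z' (delv z M) = addable z' M.
Proof.
case: z z' => [i|k] [j|l] //= nkl; rewrite !inE.
by case: (eqVneq l k) nkl => [->|_ _]; rewrite ?eqxx.
Qed.

Lemma delvK z M : (0 < mult z M)%N -> addv z (delv z M) = M.
Proof.
move=> zM; apply: monP => z'; rewrite mult_addv ?addable_delv // mult_delv.
by case: eqP => [<-|_]; rewrite ?subnK ?subn0 ?addn0.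
Qed.

Lemma addvK z M : addable z M -> delv z (addv z M) = M.
Proof.
by move=> zM; apply: monP => z'; rewrite mult_delv mult_addv // addnK.
Qed.

Lemma mult_addv_gt0 z M : addable z M -> (0 < mult z (addv z M))%N.
Proof. by move=> zM; rewrite mult_addv // eqxx addn1. Qed.

Definition wt P M : nat := \sum_(z | P z) mult z M.
Local Notation deg := (wt predT).

Lemma wt_addv P z M : addable z M -> wt P (addv z M) = (wt P M + P z)%N.
Proof.
move=> zM; rewrite /wt (eq_bigr _ (fun z' _ => mult_addv z' zM)) big_split /=.
congr (_ + _)%N; have [Pz|nPz] := boolP (P z).
  rewrite (bigD1 z) //= eqxx big1 ?addn0 // => z' /andP[_ /negPf nz'z].
  by rewrite eq_sym nz'z.
by rewrite big1 // => z' Pz'; case: eqP nPz => // ->; rewrite Pz'.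
Qed.

Lemma wt_delv P z M :
  (0 < mult z M)%N -> wt P M = (wt P (delv z M) + P z)%N.
Proof. by move=> zM; rewrite -{1}(delvK zM) wt_addv ?addable_delv. Qed.

Lemma deg_addv z M : addable z M -> deg (addv z M) = (deg M).+1.
Proof. by move=> zM; rewrite wt_addv // addn1. Qed.

Lemma deg_delv z M : (0 < mult z M)%N -> deg M = (deg (delv z M)).+1.
Proof. by move=> zM; rewrite (wt_delv _ zM) addn1. Qed.

Lemma deg_wtC P M : deg M = (wt P M + wt (predC P) M)%N.
Proof. by rewrite /wt (bigID P). Qed.

Lemma wt_gt0 P M : (0 < wt P M)%N -> exists2 z, P z & (0 < mult z M)%N.
Proof.
rewrite lt0n sum_nat_eq0 negb_forall => /existsP[z].
by rewrite negb_imply -lt0n => /andP[Pz zM]; exists z.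
Qed.

Definition mon1 : spmon := (0%MM, set0).

Lemma mult_mon1 z : mult z mon1 = 0%N.
Proof. by case: z => [i|k] /=; rewrite ?mnm0E ?inE. Qed.

Lemma deg_eq0 M : (deg M == 0%N) = (M == mon1).
Proof.
apply/idP/eqP => [|->]; last by rewrite /wt big1 // => z _; rewrite mult_mon1.
rewrite sum_nat_eq0 => /forallP dM0; apply: monP => z.
by rewrite mult_mon1; exact/eqP/(dM0 z).
Qed.

End Monomials.

Notation deg := (wt predT).

(** * Coefficients of the operators *)

Section Operators.
Variables (F : numFieldType) (p n : nat).
Local Notation W := (superpoly F p n).
Local Notation spmon := (spmon p n).
Local Notation spvar := (spvar p n).
Implicit Types (M N : spmon) (z : spvar) (P : pred spvar) (u v w : W).

Definition coef u M : F := (spcoef u M.2)@_(M.1).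

Lemma coefP u v : coef u =1 coef v -> u = v.
Proof. by move=> e; apply: spP => S; apply/mpolyP => a; exact: (e (a, S)). Qed.

Lemma coefD u v M : coef (u + v) M = coef u M + coef v M.
Proof. by rewrite /coef spcoefD mcoeffD. Qed.

Lemma coefN u M : coef (- u) M = - coef u M.
Proof. by rewrite /coef spcoefN mcoeffN. Qed.

Lemma coefZ (c : F) u M : coef (c *: u) M = c * coef u M.
Proof. by rewrite /coef spcoefZ mcoeffZ. Qed.

Lemma coef0 M : coef 0 M = 0.
Proof. by rewrite /coef spcoef0 mcoeff0. Qed.

Lemma coef_sum I (r : seq I) (f : I -> W) M :
  coef (\sum_(i <- r) f i) M = \sum_(i <- r) coef (f i) M.
Proof.
by apply: (big_morph (coef^~ M)) => [u v|]; rewrite (coefD, coef0).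
Qed.

Definition supp u : seq spmon :=
  [seq (a, B) | B <- enum {set 'I_n}, a <- msupp (spcoef u B)].

Lemma mem_supp u M : (M \in supp u) = (coef u M != 0).
Proof.
rewrite -mcoeff_msupp /coef; case: M => a S /=.
apply/allpairsPdep/idP => [[S' [a' [_ a'S [-> ->]]]] //|aS].
by exists S, a; rewrite mem_enum.
Qed.

Definition mon M : W := [ffun S => if S == M.2 then 'X_[M.1] else 0].

Lemma coef_mon M N : coef (mon M) N = (M == N)%:R.
Proof.
case: M N => a S [b T]; rewrite /coef /spcoef ffunE /= [T == S]eq_sym.
rewrite xpair_eqE andbC.
by have [_|_] := eqVneq S T; rewrite ?mcoeffX ?mcoeff0.
Qed.

Lemma spW_supp u : u = \sum_(M <- undup (supp u)) coef u M *: mon M.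
Proof.
apply: coefP => N; rewrite coef_sum.
under eq_bigr => M _ do rewrite coefZ coef_mon.
have [uN|uN] := boolP (N \in supp u).
  rewrite (bigD1_seq N) ?mem_undup ?undup_uniq //= eqxx mulr1 big1 ?addr0 //.
  by move=> M /negPf ->; rewrite mulr0.
rewrite big_seq big1.
  by apply/eqP; move: uN; rewrite mem_supp negbK.
move=> M; rewrite mem_undup; case: eqP => [->|_]; last by rewrite mulr0.
by rewrite (negPf uN).
Qed.

Lemma mon1E : mon (mon1 p n) = 1.
Proof.
apply: spP => S; rewrite spcoef1 /spcoef ffunE /=.
by case: eqP; rewrite ?mpolyX0.
Qed.

Definition vmul z u : W :=
  match z with inl i => xvar F n i * u | inr k => yvar F p k * u end.

Definition vder z u : W :=
  match z with inl i => dx i u | inr k => dy k u end.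

(** [wmul] and [wder] are indexed by the resulting monomial, whence the successor in [wder]. Each
    coefficient of [vmul z u] or [vder z u] then comes from a single coefficient of [u], so nothing
    cancels. *)
Definition wmul z M : F :=
  match z with
  | inl _ => 1
  | inr k => (-1) ^+ #|[set s in M.2 | (s < k)%N]|
  end.

Definition wder z M : F :=
  match z with
  | inl i => (M.1 i).+1%:R
  | inr k => (-1) ^+ #|[set s in M.2 | (s < k)%N]|
  end.

Lemma wmul_neq0 z M : wmul z M != 0.
Proof. by case: z => [i|k] /=; rewrite ?signr_eq0 ?oner_eq0. Qed.

Lemma wder_neq0 z M : wder z M != 0.
Proof. by case: z => [i|k] /=; rewrite ?signr_eq0 ?Num.Theory.pnatr_eq0. Qed.

(** Removing [k] does not change which odd variables precede [k], so the two signs cancel. *)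
Lemma wmul_wder z M :
  (0 < mult z M)%N -> wmul z M * wder z (delv z M) = (mult z M)%:R.
Proof.
case: z => [i|k] /= zM; first by rewrite mul1r mnmBE mnm1E eqxx subn1 prednK.
have kM : k \in M.2 by case: (k \in M.2) zM.
rewrite (card_ltD1 k kM) ltnn add0n -exprD addnn -signr_odd odd_double.
by rewrite kM.
Qed.

Lemma mcoeff_sign (b : nat) (q : {mpoly F[p]}) a :
  ((-1) ^+ b * q)@_a = (-1) ^+ b * q@_a.
Proof.
by rewrite -signr_odd -[in RHS]signr_odd; case: odd; rewrite ?mulN1r ?mul1r ?mcoeffN.
Qed.

Lemma coef_vmul z u M :
  coef (vmul z u) M =
  if (0 < mult z M)%N then wmul z M * coef u (delv z M) else 0.
Proof.
case: z M => [i|k] [a S]; rewrite /coef /=.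
  rewrite spcoef_xM mulrC mul1r; case: ifP => ai.
    have {1}<- : (U_(i) + (a - U_(i)) = a)%MM.
      by rewrite addmC; have := @delvK p n (inl i) (a, S) ai; case.
    by rewrite mcoeffMX.
  rewrite mcoeffMr big1 // => -[b c] /= /eqP e.
  rewrite mcoeffX; case: eqP => [e'|_]; last by rewrite mulr0.
  have /= := congr1 (fun m : 'X_{1..p} => m i) e.
  by rewrite mnmDE -e' mnm1E eqxx add1n => ai'; rewrite ai' in ai.
rewrite spcoef_yM lt0b; case: ifP => _; rewrite ?mcoeff0 //.
exact: mcoeff_sign.
Qed.

Lemma coef_vder z u M :
  coef (vder z u) M = if addable z M then wder z M * coef u (addv z M) else 0.
Proof.
case: z M => [i|k] [a S]; rewrite /coef /=.
  by rewrite spcoef_dx mcoeff_mderiv mulr_natl.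
by rewrite spcoef_dy; case: (k \in S); rewrite /= ?mcoeff0 // mcoeff_sign.
Qed.

Lemma vmul_mon z M :
  addable z M -> vmul z (mon M) = wmul z (addv z M) *: mon (addv z M).
Proof.
move=> zM; apply: coefP => N; rewrite coef_vmul coefZ !coef_mon.
case: ifP => zN.
  have [->|nMN] := eqVneq M (delv z N); first by rewrite delvK // eqxx.
  by case: (addv z M =P N) nMN => [<-|_ _]; rewrite ?addvK ?eqxx // !mulr0.
by case: eqP zN => [<-|]; rewrite ?mult_addv_gt0 ?mulr0.
Qed.

Lemma vder_mon z M :
  (0 < mult z M)%N -> vder z (mon M) = wder z (delv z M) *: mon (delv z M).
Proof.
move=> zM; apply: coefP => N; rewrite coef_vder coefZ !coef_mon.
case: ifP => zN.
  have [->|nMN] := eqVneq M (addv z N); first by rewrite addvK // eqxx.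
  by case: (delv z M =P N) nMN => [<-|_ _]; rewrite ?delvK ?eqxx // !mulr0.
by case: eqP zN => [<-|]; rewrite ?addable_delv ?mulr0.
Qed.

(** The sum of all [z d/dz] is the Euler operator, which scales each monomial by its degree. *)
Lemma coef_e11 (mu : F) u M : coef (e11 mu u) M = (mu - (deg M)%:R) * coef u M.
Proof.
have -> : e11 mu u = mu *: u - \sum_z vmul z (vder z u).
  by rewrite /e11 big_sumType /= opprD addrA.
rewrite coefD coefN coefZ coef_sum mulrBl; congr (_ - _).
rewrite /wt natr_sum mulr_suml; apply: eq_bigr => z _.
rewrite coef_vmul coef_vder; case: ifP => zM.
  by rewrite addable_delv // delvK // mulrA wmul_wder.
by move/negbT: zM; rewrite -eqn0Ngt => /eqP ->; rewrite mul0r.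
Qed.

Lemma coef_sp_part b u M :
  coef (sp_part b u) M = if odd #|M.2| == b then coef u M else 0.
Proof.
by rewrite /coef /sp_part {1}/spcoef ffunE; case: ifP; rewrite ?mcoeff0.
Qed.

End Operators.

(** * Submodules *)

Section Submodules.
Variables (F : numFieldType) (p n : nat).
Local Notation W := (superpoly F p n).
Local Notation spmon := (spmon p n).
Local Notation spvar := (spvar p n).
Implicit Types (M N : spmon) (z : spvar) (P : pred spvar) (u v w : W).

Lemma gl_part_delta m (b : bool) (i j : 'I_(m + n)) :
  gl_part b (delta_mx i j) =
  (gl_odd i (+) gl_odd j == b)%:R *: (delta_mx i j : 'M[F]_(m + n)).
Proof.
apply/matrixP => k l; rewrite !mxE.
have [->|_] := eqVneq k i; have [->|_] := eqVneq l j; rewrite ?mulr0 ?if_same //=.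
by case: eqP; rewrite mulr1.
Qed.

(** For [i != j] the bracket of [E_ii] and [E_ij] is [E_ij]: the product in the other order
    vanishes, whatever the parities. *)
Lemma in_sl_delta m (i j : 'I_(m + n)) :
  i != j -> in_sl (delta_mx i j : 'M[F]_(m + n)).
Proof.
move=> nij; exists [:: (delta_mx i i, delta_mx i j)].
rewrite big_seq1 /superbracket /= mul_delta_mx big1 ?subr0 // => a _.
rewrite big1 // => b _; rewrite !gl_part_delta -scalemxAl -scalemxAr.
by rewrite mul_delta_mx_0 ?scaler0 // eq_sym.
Qed.

Definition index1 : 'I_(p.+1 + n) := lshift n ord0.

Definition index_of z : 'I_(p.+1 + n) :=
  match z with inl i => lshift n (lift ord0 i) | inr k => rshift p.+1 k end.

Lemma index_of_inj : injective index_of.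
Proof.
move=> [i|k] [j|l] /eqP /=; rewrite ?eq_lshift ?eq_rshift ?eq_lrshift ?eq_rlshift //.
  by move/eqP/lift_inj => ->.
by move/eqP => ->.
Qed.

Lemma index_of_neq1 z : index_of z != index1.
Proof.
by case: z => [i|k] /=; rewrite ?eq_lshift ?eq_rlshift // eq_sym neq_lift.
Qed.

Lemma gl_index_of_index1 : gl_index_of index1 = Ifirst p n.
Proof. by rewrite /gl_index_of (unsplitK (inl _)) unlift_none. Qed.

Lemma gl_index_of_index_of z :
  gl_index_of (index_of z) =
  match z with inl i => Ieven n i | inr k => Iodd p k end.
Proof.
rewrite /gl_index_of; case: z => [i|k] /=.
  by rewrite (unsplitK (inl _)) liftK.
by rewrite (unsplitK (inr _)).
Qed.

Lemma index_ofP (i : 'I_(p.+1 + n)) : i = index1 \/ exists z, i = index_of z.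
Proof.
rewrite -(splitK i); case: (split i) => [a|k] /=; last by right; exists (inr k).
case: (unliftP ord0 a) => [j|] ->; first by right; exists (inl j).
by left.
Qed.

(** * Matrix units as operators on [W] *)

Section Action.
Variable mu : F.

Lemma e_op_z1 z w : e_op mu (index_of z) index1 w = vmul z w.
Proof. by rewrite /e_op gl_index_of_index1 gl_index_of_index_of; case: z. Qed.

Lemma e_op_1z z w : e_op mu index1 (index_of z) w = e11 mu (vder z w).
Proof. by rewrite /e_op gl_index_of_index1 gl_index_of_index_of; case: z. Qed.

Lemma e_op_zz z z' w : e_op mu (index_of z) (index_of z') w = vmul z (vder z' w).
Proof. by rewrite /e_op !gl_index_of_index_of; case: z z' => [i|k] []. Qed.

Lemma e_op_11 w : e_op mu index1 index1 w = e11 mu w.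
Proof. by rewrite /e_op gl_index_of_index1. Qed.

Lemma gl_act_delta i j w : gl_act mu (delta_mx i j) w = e_op mu i j w.
Proof.
rewrite /gl_act (bigD1 i) //= (bigD1 j) //= mxE !eqxx scale1r.
rewrite !big1 ?addr0 // => [k /negPf nki|l /negPf nlj].
  by rewrite big1 // => l _; rewrite mxE nki scale0r.
by rewrite mxE nlj andbF scale0r.
Qed.

End Action.

(** * Closure properties of an arbitrary submodule *)

Section Closure.
Variables (mu : F) (graded : bool) (U : W -> Prop).
Hypothesis subU : sl_submodule mu graded U.

Lemma submod0 : U 0. Proof. by case: subU. Qed.

Lemma submodZD c u v : U u -> U v -> U (c *: u + v).
Proof. by case: subU => _ + _ _; exact. Qed.

Lemma submodZ c u : U u -> U (c *: u).
Proof. by move=> Uu; rewrite -[_ *: _]addr0; apply: submodZD => //; exact: submod0. Qed.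

Lemma submodD u v : U u -> U v -> U (u + v).
Proof. by rewrite -{2}[u]scale1r; exact: submodZD. Qed.

Lemma submod_scale (c : F) u : c != 0 -> U (c *: u) -> U u.
Proof. by move=> c0 /(submodZ c^-1); rewrite scalerA mulVf // scale1r. Qed.

Lemma submod_sum (I : eqType) (r : seq I) (f : I -> W) :
  (forall i, i \in r -> U (f i)) -> U (\sum_(i <- r) f i).
Proof.
move=> Uf; rewrite big_seq; elim/big_ind: _ => //; first exact: submod0.
exact: submodD.
Qed.

Lemma submod_supp u : (forall M, coef u M != 0 -> U (mon F M)) -> U u.
Proof.
move=> Uu; rewrite [u]spW_supp; apply: submod_sum => M.
by rewrite mem_undup mem_supp => /Uu; exact: submodZ.
Qed.

Lemma submod_e_op i j u : i != j -> U u -> U (e_op mu i j u).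
Proof.
move=> nij Uu; rewrite -gl_act_delta; case: subU => _ _ + _; apply=> //.
exact: in_sl_delta.
Qed.

Lemma submod_vmul z u : U u -> U (vmul z u).
Proof. by rewrite -(e_op_z1 mu); apply: submod_e_op; exact: index_of_neq1. Qed.

Lemma submod_vder z u : U u -> U (e11 mu (vder z u)).
Proof. by rewrite -e_op_1z; apply: submod_e_op; rewrite eq_sym index_of_neq1. Qed.

Lemma submod_vmul_vder z z' u : z != z' -> U u -> U (vmul z (vder z' u)).
Proof.
move=> nzz'; rewrite -(e_op_zz mu); apply: submod_e_op.
by apply: contra nzz' => /eqP/index_of_inj ->.
Qed.

(** Induction on the degree: a monomial of degree above [k] is, up to a nonzero scalar, a variable
    times a monomial of degree one less. *)
Lemma submod_mon_ge k :
  (forall M, deg M = k -> U (mon F M)) ->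
  forall M, (k <= deg M)%N -> U (mon F M).
Proof.
move=> Uk M; have [e] := ubnP (deg M); elim: e M => // e IH M ltMe.
rewrite leq_eqVlt => /orP[/eqP/esym/Uk //|ltkM].
have [z _ zM] := wt_gt0 (leq_ltn_trans (leq0n k) ltkM).
have dM := deg_delv zM; rewrite dM !ltnS in ltkM ltMe.
have /(submod_vmul z) := IH _ ltMe ltkM.
rewrite vmul_mon ?addable_delv // delvK //; apply: submod_scale.
exact: wmul_neq0.
Qed.

(* Multiply u by the variables of M: its constant term contributes a multiple
   of M, and all other terms have degree at least that of M. *)
Lemma submod_mul_const u M :
  U u -> coef u (mon1 p n) != 0 ->
  exists v, [/\ U v, coef v M != 0 &
                forall N, coef v N != 0 -> (deg M <= deg N)%N].
Proof.
move=> Uu u1; have [e] := ubnP (deg M); elim: e M => // e IH M ltMe.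
have [dM0|dM_gt0] := posnP (deg M).
  have M1 : M = mon1 p n by apply/eqP; rewrite -deg_eq0 dM0.
  by exists u; rewrite dM0 M1.
have [z _ zM] := wt_gt0 dM_gt0.
have dM := deg_delv zM; rewrite dM ltnS in ltMe.
have [v [Uv vM vge]] := IH _ ltMe.
exists (vmul z v); split; first exact: submod_vmul.
  by rewrite coef_vmul zM mulf_neq0 ?wmul_neq0.
move=> N; rewrite coef_vmul; case: ifP => [zN|]; last by rewrite eqxx.
by rewrite mulf_eq0 negb_or => /andP[_ /vge]; rewrite dM (deg_delv zN).
Qed.

End Closure.

(** * The submodule of terms of degree above [d], for [mu = d] *)

Section Main.
Variables (d : nat) (graded : bool).
Let mu : F := d%:R.

Definition high u : Prop := forall M, coef u M != 0 -> (d < deg M)%N.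

Lemma highZD c u v : high u -> high v -> high (c *: u + v).
Proof.
move=> hu hv M; rewrite coefD coefZ.
have [uM0|/hu //] := eqVneq (coef u M) 0.
by rewrite uM0 mulr0 add0r; exact: hv.
Qed.

Lemma high0 : high 0.
Proof. by move=> M; rewrite coef0 eqxx. Qed.

(** The scalar [d - deg M] vanishes only for a target of degree [d], so lowering loses exactly the
    passage from degree [d+1] to [d]. This is where [mu = d] enters. *)
Lemma coef_lower_neq0 z u M :
  (coef (e11 mu (vder z u)) M != 0) =
  [&& addable z M, deg M != d & coef u (addv z M) != 0].
Proof.
rewrite coef_e11 coef_vder; case: ifP => [zM|_]; last by rewrite mulr0 eqxx.
rewrite !mulf_eq0 (negPf (wder_neq0 _ _ _)) /= negb_or; congr (~~ _ && _).
by rewrite subr_eq0 Num.Theory.eqr_nat eq_sym.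
Qed.

(** Only the lowering operators decrease the degree, and they kill degree [d+1], the only one from
    which a term could leave [high]. *)
Lemma high_e_op i j u : high u -> high (e_op mu i j u).
Proof.
move=> hu M; case: (index_ofP i) => [->|[z ->]]; case: (index_ofP j) => [->|[z' ->]].
- by rewrite e_op_11 coef_e11 mulf_eq0 negb_or => /andP[_ /hu].
- rewrite e_op_1z coef_lower_neq0 => /and3P[zM dM /hu].
  by rewrite deg_addv // ltnS leq_eqVlt eq_sym (negPf dM).
- rewrite e_op_z1 coef_vmul; case: ifP => [zM|]; last by rewrite eqxx.
  rewrite mulf_eq0 negb_or => /andP[_ /hu]; rewrite (deg_delv zM).
  exact: leqW.
- rewrite e_op_zz coef_vmul; case: ifP => [zM|]; last by rewrite eqxx.
  rewrite coef_vder; case: ifP => [z'M|]; last by rewrite mulr0 eqxx.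
  rewrite !mulf_eq0 !negb_or => /and3P[_ _ /hu].
  by rewrite deg_addv // -deg_delv.
Qed.

Lemma high_submodule : sl_submodule mu graded high.
Proof.
have highD u v : high u -> high v -> high (u + v).
  by rewrite -{2}[u]scale1r; exact: highZD.
split; [exact: high0|exact: highZD| |].
  move=> X u _ hu; rewrite /gl_act.
  elim/big_ind: _ => [||i _]; [exact: high0|exact: highD|].
  elim/big_ind: _ => [||j _]; [exact: high0|exact: highD|].
  by rewrite -[_ *: _]addr0; apply: highZD; [exact: high_e_op|exact: high0].
move=> _ b u hu M; rewrite coef_sp_part.
by case: ifP => [_ /hu|]; rewrite ?eqxx.
Qed.

Lemma not_high1 : ~ high 1.
Proof.
move=> /(_ (mon1 p n)); rewrite -mon1E coef_mon eqxx oner_eq0 => /(_ isT).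
by rewrite (eqP (_ : deg (mon1 p n) == 0%N)) // deg_eq0.
Qed.

(** * Preferred variables and the top monomial [G] *)

Section Generator.
Variables (P : pred spvar) (G : spmon).
Hypothesis degG : deg G = d.+1.
(** These two conditions drive the exchange of variables: there is room for one more preferred
    variable until [d+1] are present, and the exchange can end only at [G]. *)
Hypothesis P_addable : forall M, (wt P M < d.+1)%N -> exists2 z, P z & addable z M.
Hypothesis P_top : forall M, deg M = d.+1 -> wt P M = d.+1 -> M = G.

Lemma wt_le M : deg M = d.+1 -> (wt P M <= d.+1)%N.
Proof. by move <-; rewrite (deg_wtC P) leq_addr. Qed.

Lemma P_exchange M : deg M = d.+1 -> (wt P M < d.+1)%N ->
  exists s t, [/\ t != s, ~~ P s, P t, (0 < mult s M)%N & addable t M].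
Proof.
move=> dM ltP.
have /wt_gt0[s nPs sM] : (0 < wt (predC P) M)%N.
  by move: ltP; rewrite -dM (deg_wtC P) -{1}[wt P M]addn0 ltn_add2l.
have [t Pt tM] := P_addable ltP.
by exists s, t; split=> //; apply: contraTneq Pt => ->.
Qed.

Variable U : W -> Prop.
Hypothesis subU : sl_submodule mu graded U.

(** In degree [d+1], induction on the number of missing preferred factors: trading a non-preferred
    [s] in [M] for a preferred [t] gives a monomial already in [U], and [s d/dt] leads back to
    [M]. *)
Lemma high_generated : U (mon F G) -> forall u, high u -> U u.
Proof.
move=> UG u hu; apply: (submod_supp subU) => M /hu.
apply: (submod_mon_ge subU) => {}M.
have [e] := ubnP (d.+1 - wt P M); elim: e M => // e IH M ltMe dM.
have := wt_le dM; rewrite leq_eqVlt => /orP[/eqP/(P_top dM) ->//|ltP].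
have [s [t [nts nPs Pt sM tM]]] := P_exchange dM ltP.
have tsM : addable t (delv s M) by rewrite addable_delv_neq // eq_sym.
have tM' := mult_addv_gt0 tsM.
have wtM' : wt P (addv t (delv s M)) = (wt P M).+1.
  by rewrite wt_addv // (wt_delv P sM) Pt (negPf nPs) addn0 addn1.
have UM' : U (mon F (addv t (delv s M))).
  apply: IH; last by rewrite deg_addv // -deg_delv.
  by rewrite wtM' subnS -ltnS prednK // subn_gt0.
rewrite eq_sym in nts; have := submod_vmul_vder subU nts UM'.
rewrite vder_mon // addvK //.
have -> c w : vmul s (c *: w) = c *: vmul s w by case: (s) => i /=; rewrite scalerAr.
rewrite vmul_mon ?addable_delv // delvK // scalerA.
by apply: (submod_scale subU); rewrite mulf_neq0 ?wmul_neq0 ?wder_neq0.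
Qed.

(* Apply t d/ds with s not preferred and t preferred: this raises the least
   preferred degree occurring in u, until only G is left. *)
Lemma homogeneous_top u : U u -> u != 0 ->
  (forall M, coef u M != 0 -> deg M = d.+1) -> U (mon F G).
Proof.
(* [r] bounds the number of non-preferred factors in each monomial of [v]. *)
suff IH r v : (r <= d.+1)%N -> U v -> v != 0 ->
    (forall M, coef v M != 0 -> deg M = d.+1 /\ (d.+1 - r <= wt P M)%N) ->
    U (mon F G).
  move=> Uu u0 hu; apply: (IH d.+1 u) => // M /hu ->.
  by rewrite subnn.
elim: r v => [|r IH] v ltrd Uv v0 hv.
  have vE : v = coef v G *: mon F G.
    apply: coefP => M; rewrite coefZ coef_mon.
    have [->|nGM] := eqVneq G M; first by rewrite mulr1.
    rewrite mulr0; apply/eqP; apply: contraNT nGM => /hv[dM]; rewrite subn0 => leP.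
    by apply/eqP/esym/P_top => //; apply/eqP; rewrite eqn_leq leP wt_le.
  move: Uv; rewrite vE; apply: (submod_scale subU).
  by apply: contra_neq v0 => v0; rewrite vE v0 scale0r.
(* If no monomial attains the bound, [v] itself already satisfies the bound for [r]. *)
have [|noM] := boolP (has (fun M => wt P M == (d.+1 - r.+1)%N) (supp v)); last first.
  apply: (IH v (ltnW ltrd) Uv v0) => M vM; have [dM leM] := hv M vM; split=> //.
  have /hasPn/(_ M) := noM; rewrite mem_supp => /(_ vM) neM.
  by rewrite -subSS subSn // ltn_neqAle eq_sym neM.
case/hasP => M; rewrite mem_supp => vM /eqP wtM; have [dM _] := hv M vM.
have ltP : (wt P M < d.+1)%N by rewrite wtM subSS ltnS leq_subr.
have [s [t [nts nPs Pt sM tM]]] := P_exchange dM ltP.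
have tsM : addable t (delv s M) by rewrite addable_delv_neq // eq_sym.
apply: (IH (vmul t (vder s v)) (ltnW ltrd)).
- exact: (submod_vmul_vder subU).
(* The new vector is nonzero because the image of [M] survives. *)
- apply/eqP => /(congr1 (fun w => coef w (addv t (delv s M)))) /eqP.
  rewrite coef0 coef_vmul mult_addv_gt0 // coef_vder addvK // addable_delv // delvK //.
  by rewrite !mulf_eq0 (negPf (wmul_neq0 _ _ _)) (negPf (wder_neq0 _ _ _)) (negPf vM).
move=> N; rewrite coef_vmul; case: ifP => [tN|]; last by rewrite eqxx.
rewrite coef_vder; case: ifP => [sN|]; last by rewrite mulr0 eqxx.
rewrite !mulf_eq0 !negb_or => /and3P[_ _ /hv].
rewrite deg_addv // -deg_delv // wt_addv // (negPf nPs) addn0 => -[-> le].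
split=> //; rewrite (wt_delv P tN) Pt addn1.
by rewrite -subSS subSn.
Qed.

(** Descent on the excess [e] of the top degree over [d+1]: lowering along a variable of a top
    monomial keeps its image, since the target degree still exceeds [d]. *)
Lemma high_top u : U u -> u != 0 -> high u -> U (mon F G).
Proof.
suff IH e v : U v -> v != 0 -> high v ->
    (forall M, coef v M != 0 -> (deg M <= d.+1 + e)%N) -> U (mon F G).
  move=> Uu u0 hu; apply: (IH (\max_(M <- supp u) deg M)%N u) => // M.
  by rewrite -mem_supp => uM; apply: leq_trans (leq_addl _ _); exact: leq_bigmax_seq.
elim: e v => [|e IH] v Uv v0 hv lev.
  apply: (homogeneous_top Uv v0) => M vM; apply/eqP.
  by rewrite eqn_leq hv // andbT -[d.+1]addn0 lev.
have [|noM] := boolP (has (fun M => deg M == (d.+1 + e.+1)%N) (supp v)); last first.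
  apply: (IH v Uv v0 hv) => M vM.
  have /hasPn/(_ M) := noM; rewrite mem_supp => /(_ vM) neM.
  by rewrite -ltnS -addnS ltn_neqAle neM lev.
case/hasP => M; rewrite mem_supp => vM /eqP dM.
have [z _ zM] : exists2 z, predT z & (0 < mult z M)%N by apply: wt_gt0; rewrite dM.
have dM' : deg (delv z M) = (d.+1 + e)%N by move: dM; rewrite (deg_delv zM) addnS => -[].
apply: (IH (e11 mu (vder z v))).
- exact: (submod_vder subU).
- apply/eqP => v1; have := coef_lower_neq0 z v (delv z M).
  by rewrite v1 coef0 eqxx addable_delv // delvK // vM dM' addSnnS -{2}[d]addn0 eqn_add2l.
- by rewrite -e_op_1z; exact: high_e_op.
move=> N; rewrite coef_lower_neq0 => /and3P[zN _ /lev].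
by rewrite deg_addv // addnS.
Qed.

(** The same descent on the terms of degree at most [d], with [k] bounding their degrees: from
    degree [k+1 <= d] the target lies below [d], so the image survives, down to a constant. *)
Lemma not_high_const u : U u -> ~ high u ->
  exists v, [/\ U v, coef v (mon1 p n) != 0 &
                forall M, coef v M != 0 -> M = mon1 p n \/ (d < deg M)%N].
Proof.
suff IH k v : (k <= d)%N -> U v ->
    (exists2 M, coef v M != 0 & (deg M <= k)%N) ->
    (forall M, coef v M != 0 -> (deg M <= k)%N \/ (d < deg M)%N) ->
    exists v', [/\ U v', coef v' (mon1 p n) != 0 &
                forall M, coef v' M != 0 -> M = mon1 p n \/ (d < deg M)%N].
  move=> Uu nhu; apply: (IH d u) => // [|M _]; last by case: leqP; [left|right].
  have [/hasP[M]|/hasPn noM] := boolP (has (fun M => deg M <= d)%N (supp u)).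
    by rewrite mem_supp => uM leM; exists M.
  by case: nhu => M; rewrite -mem_supp => /noM; rewrite -ltnNge.
elim: k v => [|k IH] v ltkd Uv [M0 vM0 leM0] hv.
  have E M : (deg M <= 0)%N -> M = mon1 p n.
    by rewrite leqn0 deg_eq0 => /eqP.
  exists v; split=> //; first by rewrite -(E _ leM0).
  by move=> M /hv[/E|]; [left|right].
have [|noM] := boolP (has (fun M => deg M == k.+1) (supp v)); last first.
  have E M : coef v M != 0 -> (deg M <= k.+1)%N -> (deg M <= k)%N.
    rewrite -mem_supp => vM leM; have /hasPn/(_ M vM) neM := noM.
    by rewrite -ltnS ltn_neqAle neM.
  apply: (IH v (ltnW ltkd) Uv); first by exists M0; rewrite ?E.
  by move=> M vM; case: (hv M vM) => [/(E M vM)|]; [left|right].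
case/hasP => M; rewrite mem_supp => vM /eqP dM.
have [z _ zM] : exists2 z, predT z & (0 < mult z M)%N by apply: wt_gt0; rewrite dM.
have dM' : deg (delv z M) = k by move: dM; rewrite (deg_delv zM) => -[].
apply: (IH (e11 mu (vder z v)) (ltnW ltkd)).
- exact: (submod_vder subU).
- exists (delv z M); last by rewrite dM'.
  by rewrite coef_lower_neq0 addable_delv // delvK // vM dM' ltn_eqF.
move=> N; rewrite coef_lower_neq0 => /and3P[zN dN /hv]; rewrite deg_addv //.
case; first by left.
(* A term of degree [d+1] would land in degree [d], which [dN] excludes. *)
by rewrite ltnS leq_eqVlt eq_sym (negPf dN); right.
Qed.

Lemma not_high_full u : U u -> ~ high u -> forall w, U w.
Proof.
move=> Uu /(not_high_const Uu)[v [Uv v1 hv]].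
(* [g] has a nonzero coefficient at [G] and no term of degree below [d+1], so [high_top] applies to
   it. *)
have [g [Ug gG hg]] := submod_mul_const subU G Uv v1.
have UG : U (mon F G).
  apply: (high_top Ug); last by move=> M /hg; rewrite degG.
  by apply: contraNneq gG => ->; rewrite coef0 eqxx.
have U1 : U 1.
  apply: (submod_scale subU v1); rewrite -mon1E.
  (* The constant term cancels in the difference with [v], which therefore lies in [high]. *)
  rewrite -[_ *: _](subrK v) addrC; apply: (submodD subU) => //.
  apply: (high_generated UG) => M; rewrite coefD coefN coefZ coef_mon.
  have [<-|nM] := eqVneq (mon1 p n) M; first by rewrite mulr1 subrr eqxx.
  by rewrite mulr0 sub0r oppr_eq0 => /hv[eM|//]; rewrite eM eqxx in nM.
move=> w; apply: (submod_supp subU) => M _.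
apply: (submod_mon_ge subU (k := 0%N)) => // N /eqP.
by rewrite deg_eq0 => /eqP ->; rewrite mon1E.
Qed.

End Generator.

(** The generated submodule is identified with [high], and everything else is read off from that.
    The scalar [c] absorbs signs from ordering odd variables. *)
Lemma generated_top (P : pred spvar) (G : spmon) (g : W) (c : F) :
    deg G = d.+1 ->
    (forall M, (wt P M < d.+1)%N -> exists2 z, P z & addable z M) ->
    (forall M, deg M = d.+1 -> wt P M = d.+1 -> M = G) ->
    c != 0 -> g = c *: mon F G ->
  unique_maximal_submodule mu graded (generated_submodule mu graded g) /\
  irreducible_submodule mu graded (generated_submodule mu graded g).
Proof.
move=> dG PA PT c0 gE; set V := generated_submodule _ _ _.
have Ug U : sl_submodule mu graded U -> U g <-> U (mon F G).
  move=> sU; rewrite gE; split; first exact: (submod_scale sU c0).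
  exact: (submodZ sU).
have hG : high (mon F G).
  by move=> M; rewrite coef_mon; case: (eqVneq G M) => [<-|_]; rewrite ?dG ?eqxx.
have VE w : V w <-> high w.
  split=> [Vw|hw U sU /(Ug U sU) UG].
    by apply: Vw; [exact: high_submodule|apply/Ug => //; exact: high_submodule].
  exact: (high_generated PA PT sU UG hw).
have sV : sl_submodule mu graded V.
  have [h0 hZD hX hg] := high_submodule.
  split=> [|a u v /VE hu /VE hv|X u sX /VE hu|gr b u /VE hu]; apply/VE => //.
  - exact: hZD.
  - exact: hX.
  - exact: hg.
have properV : sub_proper V by exists 1 => /VE /not_high1.
(* Containing every proper submodule makes [V] both maximal and the only maximal one. *)
have proper_sub U : sl_submodule mu graded U -> sub_proper U -> sub_le U V.
  move=> sU [w nUw] u Uu; apply/VE => M uM; rewrite ltnNge; apply/negP => leM.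
  by case: nUw; apply: (not_high_full dG PA PT sU Uu) => /(_ M uM); rewrite ltnNge leM.
have maxV : maximal_submodule mu graded V.
  by split=> // U' sU' pU' _; exact: proper_sub.
split; first split=> // U [sU pU maxU] w.
  by split; [exact: (proper_sub U)|apply: (maxU V) => //; exact: proper_sub].
split=> //.
  exists (mon F G); split; first exact/VE.
  move=> /(congr1 (fun w => coef w G)) /eqP.
  by rewrite coef_mon eqxx coef0 oner_eq0.
move=> U sU leUV.
(* Excluded middle on whether [U] contains [G]: if not, [high_top] rules out every nonzero
   vector. *)
have [UG|nUG] := boolp.EM (U (mon F G)).
  by right=> w /VE; exact: (high_generated PA PT sU UG).
left=> u Uu; apply/eqP; apply: contra_notT nUG => u0.
by apply: (high_top PA PT sU Uu u0); apply/VE; exact: leUV.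
Qed.

End Main.
End Submodules.

(** * The two generators *)

Section HighestMonomials.
Variables (F : numFieldType) (n : nat).

Lemma xvar_expE p (i : 'I_p) k :
  xvar F n i ^+ k = mon F (iter k (addv (inl i)) (mon1 p n)).
Proof.
elim: k => [|k IH]; first by rewrite expr0 mon1E.
by rewrite exprS IH; have := vmul_mon F (z := inl i) isT; rewrite /= => ->; rewrite scale1r.
Qed.

Lemma mult_iter_addv_even p (i : 'I_p) k (z : spvar p n) :
  mult z (iter k (addv (inl i)) (mon1 p n)) = ((inl i == z) * k)%N.
Proof.
elim: k => [|k IH]; first by rewrite mult_mon1 muln0.
by rewrite iterS mult_addv // IH mulnSr.
Qed.

Lemma deg_iter_addv_even p (i : 'I_p) k :
  deg (iter k (addv (inl i)) (mon1 p n)) = k.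
Proof.
elim: k => [|k IH]; first by apply/eqP; rewrite deg_eq0.
by rewrite iterS deg_addv // IH.
Qed.

(** The exponent of the chosen variable exhausts the degree, leaving multiplicity zero for all
    others. *)
Lemma wt_even_top p (i : 'I_p) k (M : spmon p n) :
  deg M = k -> wt (pred1 (inl i)) M = k -> M = iter k (addv (inl i)) (mon1 p n).
Proof.
move=> dM wM; apply: monP => z; rewrite mult_iter_addv_even.
have [<-|nz] := eqVneq; first by rewrite mul1n -wM /wt big_pred1_eq.
apply/eqP; move/eqP: dM; rewrite (deg_wtC (pred1 (inl i))) wM -{2}[k]addn0 eqn_add2l.
by rewrite sum_nat_eq0 => /forallP/(_ z); rewrite /= eq_sym nz.
Qed.

(** The scalar is a product of sorting signs; only its being nonzero matters, and [uniq] keeps the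
    product from vanishing. *)
Lemma yvar_prodE p (s : seq 'I_n) : uniq s ->
  exists2 c : F, c != 0 &
    \prod_(k <- s) yvar F p k = c *: mon F (0%MM, [set k in s]).
Proof.
elim: s => [_|k s IH /= /andP[ks /IH[c c0 e]]].
  exists 1; rewrite ?oner_neq0 // big_nil scale1r -mon1E /mon1.
  by congr (mon F (_, _)); apply/setP => k; rewrite !inE.
have kM : addable (inr k) ((0%MM, [set l in s]) : spmon p n) by rewrite /= inE.
exists (c * wmul F (inr k) (addv (inr k) ((0%MM, [set l in s]) : spmon p n))).
  by rewrite mulf_neq0 ?wmul_neq0.
rewrite big_cons e -scalerAr set_cons -scalerA; congr (_ *: _).
exact: (vmul_mon F kM).
Qed.

Definition odd_lt p d : pred (spvar p n) :=
  fun z => if z is inr k then (k < d)%N else false.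

Lemma wt_odd_lt p d (M : spmon p n) :
  wt (@odd_lt p d) M = #|[set k : 'I_n | (k < d)%N] :&: M.2|.
Proof.
rewrite /wt big_sumType /= big_pred0 // add0n -sum1_card big_mkcond [RHS]big_mkcond.
by apply: eq_bigr => k _; rewrite !inE; case: (k < d)%N; case: (k \in M.2).
Qed.

Lemma deg_odd (M : spmon 0 n) : deg M = #|M.2|.
Proof.
rewrite /wt big_sumType /= big_ord0 add0n -sum1_card [RHS]big_mkcond.
by apply: eq_bigr => k _; case: (k \in M.2).
Qed.

Lemma card_ord_lt d : (d <= n)%N -> #|[set k : 'I_n | (k < d)%N]| = d.
Proof.
move=> led; rewrite cardsE -sum1_card -[RHS]card_ord -sum1_card.
by rewrite (big_ord_widen _ (fun=> 1%N) led).
Qed.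

End HighestMonomials.

(* m = p + 1; the variable x_2 is the one of index 0 in 'I_p. *)
Theorem theorem2p5 (R : realType) (p n : nat) (mu : R[i]) (graded : bool) :
  (forall (m_ge2 : (2 <= p.+1)%N) (d : nat), mu = d%:R ->
     let V := generated_submodule mu graded
                (xvar R[i] n (Ordinal (m_ge2 : (0 < p)%N)) ^+ d.+1) in
     unique_maximal_submodule mu graded V /\ irreducible_submodule mu graded V)
  /\
  (p.+1 = 1%N -> forall d : nat, (d < n)%N -> mu = d%:R ->
     let V := generated_submodule mu graded
                (\prod_(k < n | (k < d.+1)%N) yvar R[i] p k) in
     unique_maximal_submodule mu graded V /\ irreducible_submodule mu graded V).
Proof.
split=> [m_ge2 d -> V | [p0] d ltdn -> V].
  rewrite {}/V; set i := Ordinal _.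
  (* The only preferred variable is [x_2], whose exponent can always grow. *)
  apply: (@generated_top R[i] _ _ _ _ (pred1 (inl i))
            (iter d.+1 (addv (inl i)) (mon1 p n)) _ 1).
  - exact: deg_iter_addv_even.
  - by move=> M _; exists (inl i); rewrite //= eqxx.
  - by move=> M; exact: wt_even_top.
  - exact: oner_neq0.
  - by rewrite scale1r xvar_expE.
rewrite {}/V; subst p; set T := [set k : 'I_n | (k < d.+1)%N].
have cardT : #|T| = d.+1 by exact: card_ord_lt.
have [c c0 gE] :=
  yvar_prodE R[i] 0 (filter_uniq (fun k : 'I_n => k < d.+1)%N (index_enum_uniq 'I_n)).
apply: (@generated_top R[i] _ _ _ _ (@odd_lt n 0 d.+1) (0%MM, T) _ c).
- by rewrite deg_odd.
- move=> M; rewrite wt_odd_lt -/T => ltM.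
  (* With fewer than [d+1] preferred factors in [M], one of the [d+1] elements of [T] is still
     free. *)
  have /subsetPn[k kT kM] : ~~ (T \subset M.2).
    by apply: contraL ltM => /setIidPl ->; rewrite cardT ltnn.
  exists (inr k); last exact: kM.
  by move: kT; rewrite /T inE.
- move=> [a S]; rewrite deg_odd wt_odd_lt -/T /= => cardS cardTS.
  have -> : a = 0%MM by apply/mnmP => -[].
  (* [S] and [T] both have [d+1] elements, and so does their intersection. *)
  congr (_, _); apply/eqP; rewrite eq_sym eqEcard cardS cardT leqnn andbT.
  by apply/setIidPl/eqP; rewrite eqEcard subsetIl cardTS cardT /=.
- exact: c0.
rewrite -big_filter gE; congr (_ *: mon _ (_, _)).
by apply/setP => k; rewrite !inE mem_filter mem_index_enum andbT.
Qed.
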